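(* Let $\alpha$ be a composition. Call two standard lexical tableaux of shape $\alpha$ row-equivalent if, for each $i$, their $i$-th rows contain the same set of labels. Then the number of equivalence classes of standard lexical tableaux of shape $\alpha$ under row-equivalence equals the number of standard immaculate tableaux of shape $\alpha$.
   Context: A composition $\alpha \vDash n$ is a tuple of positive integers summing to $n$; its diagram has left-justified rows, row $i$ (from the bottom) having $\alpha_i$ cells. A word $w=w_1\cdots w_m$ is a necklace word if it is lexicographically weakly smallest among all its cyclic shifts $w_{i+1}\cdots w_m w_1\cdots w_i$. A standard lexical tableau of shape $\alpha$ is a filling of the diagram of $\alpha$ with $1,\dots,n$, each used once, such that the first column strictly increases from the bottom row upward and each row, read left to right, is a necklace word. A standard immaculate tableau of shape $\alpha$ is a filling of the diagram with $1,\dots,n$, each used once, with strictly increasing first column (from bottom upward) and each row increasing left to right. *)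

(* Defs.v *)
From mathcomp Require Import all_boot all_order.

Set Implicit Arguments.
Unset Strict Implicit.
Unset Printing Implicit Defensive.

Definition is_composition (alpha : seq nat) : bool := all (ltn 0) alpha.

(* Rows are numbered from 0, from the bottom to the top; columns are numbered *)
(* from 0, from left to right.                                                *)
Definition cell (alpha : seq nat) : finType :=
  {i : 'I_(size alpha) & 'I_(nth 0 alpha i)}.

Definition mkcell (alpha : seq nat) (i : 'I_(size alpha))
  (j : 'I_(nth 0 alpha i)) : cell alpha :=
  Tagged (fun i : 'I_(size alpha) => 'I_(nth 0 alpha i)) j.

Definition cell_row (alpha : seq nat) (c : cell alpha) : nat := tag c.
Definition cell_col (alpha : seq nat) (c : cell alpha) : nat := tagged c.

(* T c = k : 'I_n stands for the label k.+1, with n = sumn alpha.             *)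
Definition filling (alpha : seq nat) : finType :=
  {ffun cell alpha -> 'I_(sumn alpha)}.

Definition label (alpha : seq nat) (T : filling alpha) (c : cell alpha) : nat :=
  (T c).+1.

Definition standard (alpha : seq nat) (T : filling alpha) : bool :=
  [forall k : 'I_(sumn alpha), #|[set c | label T c == k.+1]| == 1].

Definition row_word (alpha : seq nat) (T : filling alpha)
  (i : 'I_(size alpha)) : seq nat :=
  [seq label T (mkcell j) | j <- enum 'I_(nth 0 alpha i)].

Definition first_column_increasing (alpha : seq nat) (T : filling alpha) : bool :=
  [forall c : cell alpha, forall c' : cell alpha,
    [&& cell_col c == 0, cell_col c' == 0 & cell_row c < cell_row c']
      ==> (label T c < label T c')].

Definition is_necklace (w : seq nat) : bool :=
  all (fun i => ((w : seqlexi nat) <= (rot i w : seqlexi nat))%O)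
      (iota 0 (size w)).

Definition lexical_tableaux (alpha : seq nat) : {set filling alpha} :=
  [set T | [&& standard T, first_column_increasing T
             & [forall i, is_necklace (row_word T i)]]].

Definition immaculate_tableaux (alpha : seq nat) : {set filling alpha} :=
  [set T | [&& standard T, first_column_increasing T
             & [forall i, sorted ltn (row_word T i)]]].

(* Sets of shifted labels: k : 'I_n stands for the label k.+1.                *)
Definition row_labels (alpha : seq nat) (T : filling alpha)
  (i : 'I_(size alpha)) : {set 'I_(sumn alpha)} :=
  [set T (mkcell j) | j : 'I_(nth 0 alpha i)].

Definition row_equiv (alpha : seq nat) : rel (filling alpha) :=
  fun T T' => [forall i, row_labels T i == row_labels T' i].

Lemma row_equiv_equivalence (alpha : seq nat) :
  equivalence_rel (@row_equiv alpha).
Proof.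
move=> T T' T''; split; first by apply/forallP=> i.
by move=> /forallP e; apply: eq_forallb => i; rewrite (eqP (e i)).
Qed.

(* Main.v *)
Require Import Defs.
From mathcomp Require Import all_boot all_order.

(** The least letter of a necklace word is its first one, and a word whose first
    letter is strictly least is a necklace word. Hence row-equivalent tableaux
    with necklace rows have the same first column, so sorting every row of a
    standard lexical tableau yields an immaculate tableau, and the immaculate
    tableaux form a transversal of the row-equivalence classes. *)

Set Implicit Arguments.
Unset Strict Implicit.
Unset Printing Implicit Defensive.

Import Order.TTheory.

Lemma equivalence_partition_transversal (I : finType) (R : rel I)
    (D X : {set I}) :
    {in D & &, equivalence_rel R} -> X \subset D ->
    {in X &, forall x y, R x y -> x = y} ->
    {in D, forall x, exists2 y, y \in X & R x y} ->
  is_transversal X (equivalence_partition R D) D.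
Proof.
move=> eqvR subXD sepX reprX; rewrite /is_transversal equivalence_partitionP //.
rewrite subXD; apply/forall_inP => _ /imsetP[x Dx ->].
have [y Xy Rxy] := reprX x Dx; have Dy := subsetP subXD y Xy.
apply/cards1P; exists y; apply/setP => z; rewrite !inE.
apply/and3P/eqP => [[Xz Dz Rxz]|->]; last by split.
by apply: sepX => //; rewrite -(eqvR x z y Dx Dz Dy).2.
Qed.

Lemma necklace_head_min (x : nat) (s : seq nat) :
  is_necklace (x :: s) -> all (leq x) s.
Proof.
move=> /allP nck; apply/allP => y s_y.
have xs_y : y \in x :: s by rewrite inE s_y orbT.
have := nck (index y (x :: s)); rewrite mem_iota index_mem xs_y => /(_ isT).
by rewrite rot_index // lexi_cons leEnat => /andP[].
Qed.

Lemma lt_head_necklace (x : nat) (s : seq nat) :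
  all (ltn x) s -> is_necklace (x :: s).
Proof.
move=> /all_nthP-/(_ x) xmin; apply/allP => -[|i]; rewrite mem_iota.
  by rewrite rot0 lexx.
rewrite add0n ltnS => lt_i_s; have lt_x : x < nth x s i := xmin i lt_i_s.
rewrite /rot /= (drop_nth x) //= lexi_cons.
by rewrite !leEnat (ltnW lt_x) leqNgt lt_x.
Qed.

Lemma sorted_ltn_necklace (w : seq nat) : sorted ltn w -> is_necklace w.
Proof.
case: w => [|x s] //= path_s.
exact: lt_head_necklace (order_path_min ltn_trans path_s).
Qed.

Section Fillings.

Variable alpha : seq nat.
Implicit Types (T : filling alpha) (i : 'I_(size alpha)) (c : cell alpha).

Lemma card_cell : #|cell alpha| = sumn alpha.
Proof.
rewrite card_tagged; congr sumn; under eq_map do rewrite card_ord.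
apply: (@eq_from_nth _ 0) => [|j]; rewrite size_map size_enum_ord // => lt_j.
by rewrite (nth_map (Ordinal lt_j)) ?size_enum_ord // nth_enum_ord.
Qed.

Lemma standardP T : reflect (injective T) (standard T).
Proof.
apply: (iffP forallP) => [std c c' eqT|injT k].
  have /cards1P[d /setP fiber_d] := std (T c).
  have := fiber_d c; have := fiber_d c'.
  by rewrite !inE /label eqT eqxx => /esym/eqP-> /esym/eqP->.
have /codomP[c ->] : k \in codom T.
  by apply: inj_card_onto; rewrite // card_ord card_cell.
apply/cards1P; exists c; apply/setP => c'.
by rewrite !inE /label eqSS (inj_eq val_inj) (inj_eq injT).
Qed.

Lemma row_labelsP T i k :
  reflect (exists2 c, tag c = i & k = T c) (k \in row_labels T i).
Proof.
apply: (iffP imsetP) => [[j _ ->]|[c <- ->]]; first by exists (mkcell j).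
by case: c => i' j; exists j.
Qed.

Lemma mem_row_labels T c : T c \in row_labels T (tag c).
Proof. by apply/row_labelsP; exists c. Qed.

Lemma standard_row_labels T :
  standard T = (\bigcup_i row_labels T i == [set: 'I_(sumn alpha)]).
Proof.
have -> : \bigcup_i row_labels T i = [set k in codom T].
  apply/setP => k; rewrite inE; apply/bigcupP/codomP => [[i _]|[c ->]].
    by case/row_labelsP => c _ ->; exists c.
  by exists (tag c) => //; apply: mem_row_labels.
have card_labels : #|'I_(sumn alpha)| = #|cell alpha|.
  by rewrite card_ord card_cell.
rewrite eqEcard subsetT cardsT cardsE card_labels /=.
apply/standardP/idP => [injT|le_card]; first by rewrite card_codom.
apply: in2T; apply/image_injP.
by rewrite eqn_leq leq_image_card.
Qed.

Lemma row_equiv_standard T T' : row_equiv T T' -> standard T = standard T'.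
Proof.
move/forallP=> eqvT; rewrite !standard_row_labels.
by under eq_bigr => i _ do rewrite (eqP (eqvT i)).
Qed.

Definition row T i : seq 'I_(sumn alpha) :=
  [seq T (mkcell j) | j <- enum 'I_(nth 0 alpha i)].

Lemma row_wordE T i : row_word T i = [seq (val k).+1 | k <- row T i].
Proof. exact: (map_comp (fun k : 'I__ => (val k).+1)). Qed.

Lemma sorted_row_word T i : sorted ltn (row_word T i) = sorted <%O (row T i).
Proof. by rewrite row_wordE sorted_map. Qed.

Lemma size_row T i : size (row T i) = nth 0 alpha i.
Proof. by rewrite size_map size_enum_ord. Qed.

Lemma nth_row T c k : nth k (row T (tag c)) (tagged c) = T c.
Proof.
by case: c => i j; rewrite (nth_map j) ?size_enum_ord //= nth_ord_enum.
Qed.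

Lemma mem_row T i : row T i =i row_labels T i.
Proof.
by move=> k; apply/mapP/imsetP => -[j _ ->]; exists j; rewrite ?mem_enum.
Qed.

Lemma uniq_row T i : injective T -> uniq (row T i).
Proof.
move=> injT; rewrite map_inj_uniq ?enum_uniq // => j j' /injT/eqP.
by rewrite eq_Tagged => /eqP.
Qed.

Lemma eq_rows T T' : row T =1 row T' -> T = T'.
Proof.
by move=> eq_row; apply/ffunP => c; rewrite -(nth_row T c (T c)) eq_row nth_row.
Qed.

Lemma necklace_row_min T c k :
    is_necklace (row_word T (tag c)) -> cell_col c = 0 ->
  k \in row_labels T (tag c) -> T c <= k.
Proof.
rewrite row_wordE /cell_col -mem_row => nck c0 row_k.
have := nth_row T c k; rewrite c0.
case: (row T (tag c)) nck row_k => // x s /necklace_head_min/=.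
rewrite all_map => /allP min_x + <-.
by rewrite inE => /predU1P[-> // | /min_x].
Qed.

Lemma row_equiv_first_column T T' c :
    row_equiv T T' -> is_necklace (row_word T (tag c)) ->
    is_necklace (row_word T' (tag c)) -> cell_col c = 0 ->
  T c = T' c.
Proof.
move=> /forallP/(_ (tag c))/eqP eqvT nckT nckT' c0.
apply/val_inj/eqP; rewrite /= eqn_leq; apply/andP; split.
  by apply: necklace_row_min; rewrite // eqvT mem_row_labels.
by apply: necklace_row_min; rewrite // -eqvT mem_row_labels.
Qed.

Lemma row_equiv_first_column_increasing T T' :
    row_equiv T T' -> (forall i, is_necklace (row_word T i)) ->
    (forall i, is_necklace (row_word T' i)) ->
  first_column_increasing T = first_column_increasing T'.
Proof.
move=> eqvT nckT nckT'; apply: eq_forallb => c; apply: eq_forallb => c'.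
case: (cell_col c =P 0) => //= c0; case: (cell_col c' =P 0) => //= c'0.
by rewrite /label !(row_equiv_first_column eqvT).
Qed.

Definition sort_rows T : filling alpha :=
  [ffun c => nth (T c) (sort <=%O (row T (tag c))) (tagged c)].

Lemma row_sort_rows T i : row (sort_rows T) i = sort <=%O (row T i).
Proof.
have sz : size (sort <=%O (row T i)) = nth 0 alpha i.
  by rewrite size_sort size_row.
case def_s: (sort _ _) sz => [|k s] sz.
  by apply: size0nil; rewrite size_row -sz.
apply: (@eq_from_nth _ k) => [|j]; rewrite size_row ?sz // => lt_j.
rewrite (nth_row _ (mkcell (Ordinal lt_j))) ffunE /= def_s.
by apply: set_nth_default; rewrite sz.
Qed.

Lemma row_equiv_sort_rows T : row_equiv T (sort_rows T).
Proof.
apply/forallP => i; apply/eqP/setP => k.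
by rewrite -!mem_row row_sort_rows mem_sort.
Qed.

Lemma sorted_sort_rows T i :
  injective T -> sorted ltn (row_word (sort_rows T) i).
Proof.
by move=> injT; rewrite sorted_row_word row_sort_rows sort_lt_sorted uniq_row.
Qed.

Lemma sort_rows_immaculate T :
  T \in lexical_tableaux alpha -> sort_rows T \in immaculate_tableaux alpha.
Proof.
rewrite !inE => /and3P[std col /forallP nck].
have eqvT := row_equiv_sort_rows T.
have sortedT i := sorted_sort_rows i (standardP T std).
apply/and3P; split; [by rewrite -(row_equiv_standard eqvT) | | exact/forallP].
rewrite -(row_equiv_first_column_increasing eqvT) // => i.
exact: sorted_ltn_necklace.
Qed.

Lemma immaculate_sub_lexical :
  immaculate_tableaux alpha \subset lexical_tableaux alpha.
Proof.
apply/subsetP => T; rewrite !inE => /and3P[-> -> /forallP sortedT] /=.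
by apply/forallP => i; apply: sorted_ltn_necklace.
Qed.

Lemma immaculate_row_equiv_eq :
  {in immaculate_tableaux alpha &, forall T T', row_equiv T T' -> T = T'}.
Proof.
move=> T T'; rewrite !inE => /and3P[_ _ /forallP sT] /and3P[_ _ /forallP sT'].
move=> /forallP eqvT; apply: eq_rows => i.
apply: lt_sorted_eq; rewrite -?sorted_row_word // => k.
by rewrite !mem_row (eqP (eqvT i)).
Qed.

End Fillings.

Theorem theorem3p6 (alpha : seq nat) (halpha : is_composition alpha) :
  #|equivalence_partition (@row_equiv alpha) (lexical_tableaux alpha)|
  = #|immaculate_tableaux alpha|.
Proof.
apply/esym/card_transversal/equivalence_partition_transversal.
- by move=> T T' T'' _ _ _; apply: row_equiv_equivalence.
- exact: immaculate_sub_lexical.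
- exact: immaculate_row_equiv_eq.
- move=> T lexT; exists (sort_rows T); first exact: sort_rows_immaculate.
  exact: row_equiv_sort_rows.
Qed.
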